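(* Let $\delta\in(0,n]$ and let $w$ be a ($\mathcal H^\delta_\infty$-)capacitary weight on $\mathbb R^n$. Then the following statements are equivalent: (i) $\mathcal M_{\mathcal H^\delta_\infty}: L^1_w(\mathbb R^n,\mathcal H^\delta_\infty)\to L^{1,\infty}_w(\mathbb R^n,\mathcal H^\delta_\infty)$ is bounded, i.e. there is a constant $K>0$ such that for all $f\in L^1_w(\mathbb R^n,\mathcal H^\delta_\infty)$ and all $t\in(0,\infty)$, $$w_{\mathcal H^\delta_\infty}\left(\left\{x\in\mathbb R^n:\ \mathcal M_{\mathcal H^\delta_\infty}f(x)>t\right\}\right)\le\frac{K}{t}\int_{\mathbb R^n}|f(x)|\,w(x)\,d\mathcal H^\delta_\infty;$$ (ii) $w\in\mathcal A_{1,\delta}$, i.e. there is $K\in(0,\infty)$ such that $\mathcal M_{\mathcal H^\delta_\infty}w(x)\le K\,w(x)$ for $\mathcal H^\delta_\infty$-almost every $x\in\mathbb R^n$.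
   Context: A cube $Q\subset\mathbb R^n$ is a left-open right-closed cube with sides parallel to the axes; $l(Q)$ is its edge length. For $\delta\in(0,n]$ and $E\subset\mathbb R^n$, the Hausdorff content is $\mathcal H^\delta_\infty(E):=\inf\{\sum_i l(Q_i)^\delta:\ E\subset\bigcup_i Q_i\}$, the infimum over all finite or countable coverings of $E$ by cubes. For $E\subset\mathbb R^n$ and a non-negative function $g$ (no measurability required) the Choquet integral is $\int_E g\,d\mathcal H^\delta_\infty:=\int_0^\infty \mathcal H^\delta_\infty(\{x\in E: g(x)>t\})\,dt$. ''Almost everywhere'' with respect to $\mathcal H^\delta_\infty$ means outside a set of zero $\mathcal H^\delta_\infty$-content. $L^1_{\rm loc}(\mathbb R^n,\mathcal H^\delta_\infty)$ is the set of functions $f$ with $\int_E|f|\,d\mathcal H^\delta_\infty<\infty$ for all compact $E\subset\mathbb R^n$. A capacitary weight is a non-negative function $w\in L^1_{\rm loc}(\mathbb R^n,\mathcal H^\delta_\infty)$ with $w\in(0,\infty)$ $\mathcal H^\delta_\infty$-almost everywhere. For $F\subset\mathbb R^n$, $w_{\mathcal H^\delta_\infty}(F):=\int_F w\,d\mathcal H^\delta_\infty$. $L^1_w(\mathbb R^n,\mathcal H^\delta_\infty)$ is the set of functions $f$ with $\int_{\mathbb R^n}|f|w\,d\mathcal H^\delta_\infty<\infty$; $L^{1,\infty}_w(\mathbb R^n,\mathcal H^\delta_\infty)$ is the set of functions $f$ with $\sup_{t>0}t\,w_{\mathcal H^\delta_\infty}(\{|f|>t\})<\infty$. The capacitary maximal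 operator is $\mathcal M_{\mathcal H^\delta_\infty}f(x):=\sup_{Q\ni x}\frac1{\mathcal H^\delta_\infty(Q)}\int_Q|f(y)|\,d\mathcal H^\delta_\infty\in[0,\infty]$, the supremum over all cubes $Q$ containing $x$. *)

(* Defs.v *)
From HB Require Import structures.
From mathcomp Require Import all_boot all_order all_algebra.
From mathcomp Require Import all_classical all_reals all_analysis.

Set Implicit Arguments.
Unset Strict Implicit.
Unset Printing Implicit Defensive.

Import Order.TTheory GRing.Theory Num.Theory.
Import numFieldNormedType.Exports.

Local Open Scope classical_set_scope.
Local Open Scope ring_scope.
Local Open Scope ereal_scope.

(* R^n is 'rV[R]_n, and functions on it are extended-real valued: the weights
   and the maximal function may take the value +oo. *)
Section HausdorffContent.
Variables (R : realType) (n : nat).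
Implicit Types (a x : 'rV[R]_n) (l d : R) (E Q F : set 'rV[R]_n).
Implicit Types (f g w : 'rV[R]_n -> \bar R).

Definition cube a l : set 'rV[R]_n :=
  [set x | forall i, (a ord0 i < x ord0 i <= a ord0 i + l)%R].

Definition is_cube Q : Prop := exists a l, (0 < l)%R /\ Q = cube a l.

(* The index set D ranges over all subsets of nat, so that the coverings are
   exactly the finite (possibly empty) or countable ones. *)
Definition hcontent d E : \bar R :=
  ereal_inf [set s | exists (D : set nat) (a : nat -> 'rV[R]_n) (l : nat -> R),
    [/\ forall i, D i -> (0 < l i)%R,
        E `<=` \bigcup_(i in D) cube (a i) (l i)
      & s = \esum_(i in D) (l i `^ d)%:E]].

(* For g >= 0. The integrand is nonincreasing in t, hence measurable, whatever
   E and g are. *)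
Definition choquet d E g : \bar R :=
  \int[lebesgue_measure]_(t in `]0%R, +oo[) hcontent d [set x | E x /\ t%:E < g x].

Definition content_ae d (P : 'rV[R]_n -> Prop) : Prop :=
  exists N, hcontent d N = 0 /\ forall x, ~ N x -> P x.

Definition L1loc d f : Prop :=
  forall E, compact E -> choquet d E (fun x => `|f x|) < +oo.

Definition capacitary_weight d w : Prop :=
  [/\ forall x, 0 <= w x, L1loc d w & content_ae d (fun x => 0 < w x < +oo)].

Definition wcontent d w F : \bar R := choquet d F w.

Definition L1w d w f : Prop := choquet d setT (fun x => `|f x| * w x) < +oo.

Definition maximal d f x : \bar R :=
  ereal_sup [set (hcontent d Q)^-1 * choquet d Q (fun y => `|f y|) |
             Q in [set Q | is_cube Q /\ Q x]].

Definition maximal_weak11 d w : Prop :=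
  exists K : R, (0 < K)%R /\
    forall f, L1w d w f -> forall t : R, (0 < t)%R ->
      wcontent d w [set x | t%:E < maximal d f x] <=
      (K / t)%:E * choquet d setT (fun x => `|f x| * w x).

Definition A1 d w : Prop :=
  exists K : R, (0 < K)%R /\
    content_ae d (fun x => maximal d w x <= K%:E * w x).

End HausdorffContent.

(* Main.v *)
From HB Require Import structures.
Require Import Defs.
From mathcomp Require Import all_boot all_order all_algebra.
From mathcomp Require Import all_classical all_reals all_analysis.
From mathcomp Require Import measurable_realfun zify ring lra.

Set Implicit Arguments.
Unset Strict Implicit.
Unset Printing Implicit Defensive.

Import Order.TTheory GRing.Theory Num.Theory.
Import numFieldNormedType.Exports.

Local Open Scope classical_set_scope.
Local Open Scope ring_scope.
Local Open Scope ereal_scope.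

(** Write H for the content, I for the Choquet integral and w(E) for the
integral of w over E.

Weak type implies A1. Fix a cube Q and let F be the set of points of Q where w
is smaller than a third of w(Q) / (K H(Q)). The maximal function of the
indicator of F is at least H(F) / H(Q) on Q, whereas the integral of w over F is
small, and the weak type inequality is contradicted unless H(F) = 0
([low_set_null]). Every cube is contained in a cube of comparable size out of a
countable family, the dilates of the dyadic cubes, so that one negligible set
serves for all cubes ([weak_type_A1]).

A1 implies weak type. A point where the maximal function exceeds t lies in the
dilate of a heavy dyadic cube, on which the mean of |f| exceeds a multiple of t
([maximal_gt_heavy]). On a heavy cube P the A1 condition bounds w on the dilate
of P by a multiple of 1/t times the integral of |f| w over P. Summing over the
maximal heavy cubes would finish the proof if H were additive; it is not, and
the sum of the integrals over disjoint cubes can be much larger than the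
integral over their union. The remedy is the packing argument of Melnikov: keep
a subfamily S that puts at most twice the weight of Q into any dyadic cube Q.
Integrals over the members of S do add up, up to a constant
([packing_choquet]), and a heavy cube that was left out lies below a dyadic cube
Q whose weight is already filled by the members of S below it
([packing_selection]). For such Q the A1 condition still bounds w on the dilate
of Q by the integrals of |f| w over the members of S below Q
([wcontent_dilate_le]), and the dilates of the maximal such Q cover the level
set.

Both passages to maximal cubes need the families to be bounded above along
chains of ancestors. This holds because the weighted content of the ancestors of
a dyadic cube is unbounded for a weight in A1 ([wcontent_ancestor_unbounded]),
whereas it is bounded along the two families by the integral of |f| w. *)

(** * Sums of nonnegative extended reals *)

Section Sums.
Variable R : realType.

Lemma sub_esum (T : choiceType) (I J : set T) (a : T -> \bar R) :
  I `<=` J -> \esum_(i in I) a i <= \esum_(i in J) a i.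
Proof.
move=> IJ; apply: ge_ereal_sup => _ [X [finX XI] <-].
by apply: ereal_sup_ubound; exists X => //; split=> //; exact: subset_trans IJ.
Qed.

Lemma fsum_le_esum (T : choiceType) (I X : set T) (a : T -> \bar R) :
  finite_set X -> X `<=` I -> \sum_(i \in X) a i <= \esum_(i in I) a i.
Proof. by move=> finX XI; apply: esum_ge; exists X. Qed.

Lemma esum_le_fsum (T : choiceType) (I : set T) (a : T -> \bar R) (y : \bar R) :
  (forall X, finite_set X -> X `<=` I -> \sum_(i \in X) a i <= y) ->
  \esum_(i in I) a i <= y.
Proof. by move=> le_y; apply: ge_ereal_sup => _ [X [finX XI] <-]; exact: le_y. Qed.

Lemma exchange_esum (T1 T2 : choiceType) (I : set T1) (J : set T2)
    (a : T1 -> T2 -> \bar R) : (forall i j, 0 <= a i j) ->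
  \esum_(i in I) \esum_(j in J) a i j = \esum_(j in J) \esum_(i in I) a i j.
Proof.
move=> a0; rewrite !esum_esum//.
rewrite (@reindex_esum R _ _ (J `*`` fun=> I) (I `*`` fun=> J)
  (fun z => (z.2, z.1)))//; split.
- by move=> [i j] /= [].
- by move=> [i j] [k l] _ _ [-> ->].
- by move=> [i j] /= [? ?]; exists (j, i).
Qed.

Lemma esumZl (T : choiceType) (I : set T) (a : T -> \bar R) (c : R) :
  (0 <= c)%R -> (forall i, 0 <= a i) ->
  \esum_(i in I) (c%:E * a i) = c%:E * \esum_(i in I) a i.
Proof.
move=> c0 a0; apply/eqP; rewrite eq_le; apply/andP; split.
  apply: esum_le_fsum => X finX XI.
  rewrite -ge0_mule_fsumr// lee_wpmul2l// ?lee_fin//.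
  exact: fsum_le_esum.
have [->|c_neq0] := eqVneq c 0%R.
  by rewrite mul0e; apply: esum_ge0 => i _; rewrite mul0e.
have c_gt0 : (0 < c)%R by rewrite lt_neqAle eq_sym c_neq0.
rewrite -lee_pdivlMl//; apply: esum_le_fsum => X finX XI.
rewrite lee_pdivlMl// ge0_mule_fsumr//.
exact: fsum_le_esum.
Qed.

(** A sum over a countable type as a series, which is the form in which it can be
integrated term by term. *)
Lemma esum_pickle (T : countType) (D : set T) (a : T -> \bar R) :
    (forall i, 0 <= a i) ->
  \esum_(i in D) a i =
  \sum_(k <oo) (if pickle_inv k is Some i then
                  if i \in D then a i else 0 else 0).
Proof.
move=> a0; rewrite nneseries_esumT; last first.
  by move=> k; case: pickle_inv => // i; case: ifP.
rewrite esum_mkcond.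
transitivity (\esum_(k in pickle @` [set: T]) (if pickle_inv k is Some i then
                  if i \in D then a i else 0 else 0)).
  rewrite esum_image; last by move=> i j _ _; exact: (pcan_inj (@pickleK T)).
  by apply: eq_esum => i _; rewrite pickleK_inv.
rewrite [LHS]esum_mkcond; apply: eq_esum => k _.
case: ifPn => // /negP kN; case ki : (pickle_inv k) => [i|//].
exfalso; apply: kN; rewrite inE; exists i => //.
by have := @pickle_invK T k; rewrite ki.
Qed.

Lemma esum_geometric_le (T : countType) (D : set T) (e : R) : (0 <= e)%R ->
  \esum_(i in D) (e / (2 ^ (pickle i).+1)%:R)%:E <= e%:E.
Proof.
move=> e0.
rewrite -(@esum_image R _ _ D pickle (fun k => (e / (2 ^ k.+1)%:R)%:E)); last first.
  by move=> i j _ _; exact: (pcan_inj (@pickleK T)).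
apply: le_trans (sub_esum _ (@subsetT _ _)) _.
rewrite -nneseries_esumT; last by move=> k; rewrite lee_fin divr_ge0.
apply: (@le_trans _ _ (\sum_(i <oo) (0 + (e / (2 ^ i.+1)%:R)%:E))).
  by under [leRHS]eq_eseriesr do rewrite add0e.
apply: le_trans (@epsilon_trick R (fun=> 0) e xpredT (fun=> lexx _) e0) _.
by rewrite eseries0 ?add0e.
Qed.

Lemma esum_seq_le (T : choiceType) (s : seq T) (a : T -> \bar R) (c : R) :
    (0 <= c)%R -> (forall x, x \in s -> a x <= c%:E) ->
  \esum_(x in [set` s]) a x <= ((size s)%:R * c)%:E.
Proof.
move=> c0 ac; apply: (@le_trans _ _ (\esum_(x in [set` s]) c%:E)).
  by apply: le_esum => x; exact: ac.
rewrite (_ : [set` s] = [set` undup s]); last first.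
  by apply/seteqP; split=> x; rewrite /= mem_undup.
rewrite esum_fset// -fsbig_seq ?undup_uniq// sumEFin lee_fin.
rewrite big_const_seq count_predT iter_addr_0 -[leLHS]mulr_natl ler_wpM2r// ler_nat.
exact: size_undup.
Qed.

Lemma esum_disjoint_le (T1 T2 : choiceType) (M : set T1)
    (S : T1 -> set T2) (U : set T2) (g : T2 -> \bar R) :
    (forall x, 0 <= g x) -> (forall i, M i -> S i `<=` U) ->
    (forall i j x, M i -> M j -> S i x -> S j x -> i = j) ->
  \esum_(i in M) \esum_(x in S i) g x <= \esum_(x in U) g x.
Proof.
move=> g0 SU disj; rewrite esum_esum//.
rewrite -(@esum_image R _ _ (M `*`` S) snd g).
  by apply: sub_esum => _ [[i x] [/= Mi Six] <-]; exact: SU Six.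
move=> [i x] [j y]; rewrite !inE /= => -[Mi Six] [Mj Sjy] xy.
by move: Sjy; rewrite -xy => Sjx; rewrite (disj i j x).
Qed.

End Sums.

(** * Hausdorff content *)

Section Content.
Variables (R : realType) (n : nat) (d : R).
Implicit Types (E F : set 'rV[R]_n).
Local Notation H := (@hcontent R n d).

Lemma hcontent_le_cover (T : countType) (D : set T) (a : T -> 'rV[R]_n)
    (l : T -> R) E : (forall i, D i -> (0 < l i)%R) ->
    E `<=` \bigcup_(i in D) cube (a i) (l i) ->
  H E <= \esum_(i in D) (l i `^ d)%:E.
Proof.
move=> l0 EU; apply: ereal_inf_lbound.
pose a' k := if pickle_inv k is Some i then a i else 0%R.
pose l' k := if @pickle_inv T k is Some i then l i else 1%R.
exists (pickle @` D), a', l'; split.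
- by move=> _ [i Di <-]; rewrite /l' pickleK_inv; exact: l0.
- move=> x /EU[i Di Dx]; exists (pickle i); first by exists i.
  by rewrite /a' /l' pickleK_inv.
- rewrite esum_image; last by move=> i j _ _; exact: (pcan_inj (@pickleK T)).
  by apply: eq_esum => i _; rewrite /l' pickleK_inv.
Qed.

Lemma hcontent_lt_cover E (y : \bar R) : H E < y ->
  exists (D : set nat) (a : nat -> 'rV[R]_n) (l : nat -> R),
    [/\ forall i, D i -> (0 < l i)%R,
        E `<=` \bigcup_(i in D) cube (a i) (l i)
      & \esum_(i in D) (l i `^ d)%:E < y].
Proof.
by move=> /ereal_inf_lt[_ [D [a [l [l0 EU ->]]]] lty]; exists D, a, l; split.
Qed.

Lemma hcontent_ge0 E : 0 <= H E.
Proof.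
apply: le_ereal_inf_tmp => _ [D [a [l [_ _ ->]]]].
by apply: esum_ge0 => i _; rewrite lee_fin powR_ge0.
Qed.

Lemma le_hcontent E F : E `<=` F -> H E <= H F.
Proof.
move=> EF; apply: ereal_inf_le_tmp => _ [D [a [l [l0 FU ->]]]].
by exists D, a, l; split => //; exact: subset_trans FU.
Qed.

Lemma hcontent_cube_le a (l : R) : (0 < l)%R -> H (cube a l) <= (l `^ d)%:E.
Proof.
move=> l0.
have := @hcontent_le_cover unit setT (fun=> a) (fun=> l) (cube a l) (fun _ _ => l0).
rewrite (_ : [set: unit] = [set tt]); last by apply/seteqP; split => -[].
by rewrite esum_set1 ?lee_fin ?powR_ge0//; apply => x Qx; exists tt.
Qed.

Lemma hcontent_sub (T : countType) (D : set T) E (F : T -> set 'rV[R]_n) :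
  E `<=` \bigcup_(i in D) F i -> H E <= \esum_(i in D) H (F i).
Proof.
move=> EF; have F0 i : 0 <= H (F i) by exact: hcontent_ge0.
have [Fy|] := pselect (exists2 i, D i & H (F i) = +oo).
  case: Fy => i Di Fi; suff -> : \esum_(i in D) H (F i) = +oo by rewrite leey.
  have : \sum_(j \in [set i]) H (F j) <= \esum_(j in D) H (F j).
    by apply: fsum_le_esum => // j ->.
  by rewrite fsbig_set1 Fi leye_eq => /eqP.
move=> /forall2NP Ffin; apply/lee_addgt0Pr => e e0.
pose r i := (e / (2 ^ (@pickle T i).+1)%:R)%R.
have r0 i : (0 < r i)%R by rewrite divr_gt0// ltr0n expn_gt0.
have /choice[c cP] i : exists c : set nat * (nat -> 'rV[R]_n) * (nat -> R),
    D i -> [/\ forall j, c.1.1 j -> (0 < c.2 j)%R,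
      F i `<=` \bigcup_(j in c.1.1) cube (c.1.2 j) (c.2 j)
      & \esum_(j in c.1.1) (c.2 j `^ d)%:E <= H (F i) + (r i)%:E].
  have [Di|nDi] := pselect (D i); last by exists (set0, fun=> 0%R, fun=> 0%R).
  have : H (F i) < H (F i) + (r i)%:E.
    by rewrite lteDl ?lte_fin// ge0_fin_numE// ltey; have [//|/eqP] := Ffin i.
  by move=> /hcontent_lt_cover[J [a [l [l0 FU /ltW le_r]]]]; exists (J, a, l).
pose DD : set (T * nat) := D `*`` (fun i => (c i).1.1).
apply: (@le_trans _ _ (\esum_(k in DD) ((c k.1).2 k.2 `^ d)%:E)).
  apply: (@hcontent_le_cover _ DD (fun k => (c k.1).1.2 k.2) (fun k => (c k.1).2 k.2)).
    by move=> [i j] [/= /cP[l0 _ _] /l0].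
  move=> x /EF[i Di Fx]; have [_ /(_ x Fx)[j Jj xj] _] := cP _ Di.
  by exists (i, j).
rewrite -(@esum_esum _ _ _ D _ (fun i j => ((c i).2 j `^ d)%:E)); last first.
  by move=> i j _ _; rewrite lee_fin powR_ge0.
apply: (@le_trans _ _ (\esum_(i in D) (H (F i) + (r i)%:E))).
  by apply: le_esum => i /cP[].
rewrite esumD//; last by move=> i _; rewrite lee_fin ltW.
rewrite leeD2l//; apply: esum_geometric_le; exact: ltW.
Qed.

Lemma hcontent0 : H set0 = 0.
Proof.
apply/eqP; rewrite eq_le hcontent_ge0 andbT.
have := @hcontent_le_cover nat set0 (fun=> 0%R) (fun=> 1%R) set0.
by rewrite esum_set0; apply => [|x].
Qed.

Lemma hcontentU E F : H (E `|` F) <= H E + H F.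
Proof.
apply: (@le_trans _ _ (\esum_(b in [set: bool]) H (if b then E else F))).
  by apply: hcontent_sub => x [Ex|Fx]; [exists true|exists false].
rewrite (esumID [set true])/=; last by move=> *; exact: hcontent_ge0.
rewrite [_ `&` [set _]](_ : _ = [set true]); last by apply/seteqP; split => -[] // [].
rewrite [_ `&` ~` _](_ : _ = [set false]); last first.
  by apply/seteqP; split => -[] //= [_ /(_ erefl)].
by rewrite !esum_set1 ?hcontent_ge0.
Qed.

Lemma hcontent_null_bigcup (T : countType) (F : T -> set 'rV[R]_n) :
  (forall i, H (F i) = 0) -> H (\bigcup_i F i) = 0.
Proof.
move=> F0; apply/eqP; rewrite eq_le hcontent_ge0 andbT.
by apply: le_trans (@hcontent_sub T setT _ F _) _ => //; rewrite esum1.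
Qed.

Lemma hcontentD_null E N : H N = 0 -> H (E `\` N) = H E.
Proof.
move=> N0; apply/eqP; rewrite eq_le le_hcontent//=.
rewrite -[leRHS]adde0 -N0; apply: le_trans (hcontentU _ _).
apply: le_hcontent => x Ex; have [Nx|nNx] := pselect (N x); [by right|by left].
Qed.

(** Countable subadditivity reduces an upper bound by the content to cubes: evaluate
phi on the members of a covering. *)
Lemma le_hcontent_of_cubes (phi : set 'rV[R]_n -> \bar R) (C : R) :
    (0 < C)%R ->
    (forall (D : set nat) E (F : nat -> set _), E `<=` \bigcup_(i in D) F i ->
       phi E <= \esum_(i in D) phi (F i)) ->
    (forall a l, (0 < l)%R -> phi (cube a l) <= (C * l `^ d)%:E) ->
  forall E, phi E <= C%:E * H E.
Proof.
move=> C0 phi_sub phi_cube E.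
apply/lee_addgt0Pr => e e0.
have [->|Hfin] := eqVneq (H E) +oo.
  by rewrite gt0_muley ?addye ?leey// lte_fin.
have [r [r0 rC]] : exists r : R, (0 < r)%R /\ (C * r <= e)%R.
  by exists (e / C)%R; rewrite divr_gt0// mulrC divfK// gt_eqF.
have : H E < H E + r%:E.
  by rewrite lteDl ?lte_fin// ge0_fin_numE ?hcontent_ge0// ltey.
move=> /hcontent_lt_cover[D [a [l [l0 EU /ltW le_r]]]].
apply: le_trans (phi_sub D _ _ EU) _.
apply: (@le_trans _ _ (\esum_(i in D) (C%:E * (l i `^ d)%:E))).
  by apply: le_esum => i Di; rewrite -EFinM phi_cube// l0.
rewrite esumZl ?(ltW C0)//; last by move=> i; rewrite lee_fin powR_ge0.
apply: (@le_trans _ _ (C%:E * (H E + r%:E))); first by rewrite lee_wpmul2l// lee_fin ltW.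
by rewrite ge0_muleDr ?hcontent_ge0 ?lee_fin ?(ltW r0)// leeD2l// lee_fin.
Qed.

End Content.

(** * The Choquet integral *)

Section Layers.
Variable R : realType.
Local Notation mu := (@lebesgue_measure R).

(** The contents of the superlevel sets of an arbitrary function are nonincreasing
in the level; this is what makes layer by layer integration legitimate. *)
Lemma nonincreasing_emeasurable (D : set (measurableTypeR R)) (f : R -> \bar R) :
  measurable D -> {homo f : s t / (s <= t)%R >-> t <= s} -> measurable_fun D f.
Proof.
move=> mD f_ni; apply: (measurability (@ErealGenCInfty.G R)) => [|/= _ [_] [r] -> <-].
  exact: ErealGenCInfty.measurableE.
apply: measurableI => //; apply: is_interval_measurable => s t/=.
rewrite !in_itv/= !andbT => fs ft u /andP[su ut].
by rewrite in_itv/= andbT (le_trans ft)// f_ni.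
Qed.

(** Lebesgue measure on the line is homogeneous, so that a nonnegative
integral over the half line rescales under a dilation of the variable. *)
Lemma ge0_integral_dilate (c : R) (f : R -> \bar R) : (0 < c)%R ->
    measurable_fun [set: measurableTypeR R] f -> (forall t, 0 <= f t) ->
  \int[mu]_(t in `]0%R, +oo[) f t = c%:E * \int[mu]_(t in `]0%R, +oo[) f (c * t)%R.
Proof.
move=> c0 mf f0.
pose phi : measurableTypeR R -> measurableTypeR R := fun t => (c * t)%R.
have mphi : measurable_fun setT phi by exact: mulrl_measurable.
pose push := measure_function_pushforward__canonical__measure_function_Measure mu mphi.
pose nu := mscale (NngNum (ltW c0)) push.
have nuE A : measurable A -> mu A = nu A.
  apply: lebesgue_measure_unique => _ [[a b] _ <-].
  change (mu `]a, b]%classic = c%:E * mu (phi @^-1` `]a, b]%classic)).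
  have -> : phi @^-1` `]a, b]%classic = `](c^-1 * a)%R, (c^-1 * b)%R]%classic.
    apply/seteqP; split => t /=; rewrite !in_itv/= /phi.
      by rewrite ltr_pdivrMl// ler_pdivlMl.
    by rewrite ltr_pdivrMl// ler_pdivlMl.
  rewrite !lebesgue_measure_itv/= !lte_fin ltr_pM2l ?invr_gt0//.
  case: ifPn; last by rewrite mule0.
  by move=> _; rewrite -EFinD -EFinM -mulrBr mulrA divff ?gt_eqF// mul1r.
rewrite (eq_measure_integral nu); last by move=> A mA _; exact: nuE.
rewrite /nu ge0_integral_mscale//; last exact: measurable_funS mf.
rewrite ge0_integral_pushforward//; last exact: measurable_funS mf.
congr (_ * _); congr (integral _ _ _).
by apply/seteqP; split => t /=; rewrite !in_itv/= !andbT /phi pmulr_rgt0.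
Qed.

Lemma integral_step (b : R) (c : \bar R) : (0 <= b)%R -> 0 <= c ->
  \int[mu]_(t in `]0%R, +oo[) (if (t < b)%R then c else 0) = b%:E * c.
Proof.
move=> b0 c0.
have mb : measurable (`]-oo, b[%classic : set R) by exact: measurable_itv.
transitivity (\int[mu]_(t in `]0%R, +oo[) (c * (\1_(`]-oo, b[%classic : set R) t)%:E)).
  apply: eq_integral => t _; rewrite indicE mem_setE in_itv/=.
  by case: ifP; rewrite ?mule1 ?mule0.
rewrite ge0_integralZl//; last exact/measurable_EFinP.
rewrite integral_indic//= muleC; congr (_ * _).
have -> : `]-oo, b[%classic `&` `]0%R, +oo[%classic = `]0%R, b[%classic :> set R.
  apply/seteqP; split => t /=; rewrite !in_itv/= andbT; first by move=> [-> ->].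
  by move=> /andP[-> ->].
rewrite lebesgue_measure_itv/= lte_fin; case: ifPn; first by rewrite sube0.
by rewrite -leNgt => b0'; congr EFin; apply/eqP; rewrite eq_le b0 b0'.
Qed.

End Layers.

Section Choquet.
Variables (R : realType) (n : nat) (d : R).
Implicit Types (E F N : set 'rV[R]_n) (f g : 'rV[R]_n -> \bar R) (t : R).
Local Notation H := (@hcontent R n d).
Local Notation I := (@choquet R n d).

Lemma hcontent_layer_ni E g :
  {homo (fun t => H [set x | E x /\ t%:E < g x]) : s t / (s <= t)%R >-> t <= s}.
Proof.
move=> s t st; apply: le_hcontent => x [Ex tg]; split=> //.
by apply: le_lt_trans tg; rewrite lee_fin.
Qed.

Lemma measurable_layer E g (D : set (measurableTypeR R)) : measurable D ->
  measurable_fun D (fun t => H [set x | E x /\ t%:E < g x]).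
Proof. by move=> mD; apply: nonincreasing_emeasurable => //; exact: hcontent_layer_ni. Qed.

Lemma choquet_ge0 E g : 0 <= I E g.
Proof. by apply: integral_ge0 => t _; exact: hcontent_ge0. Qed.

Lemma le_choquet_layer E F f g :
  (forall t, (0 < t)%R ->
    H [set x | E x /\ t%:E < f x] <= H [set x | F x /\ t%:E < g x]) ->
  I E f <= I F g.
Proof.
move=> fg; apply: ge0_le_integral => //.
- by move=> t _; exact: hcontent_ge0.
- exact: measurable_layer.
- exact: measurable_layer.
- by move=> t; rewrite /= in_itv/= andbT; exact: fg.
Qed.

Lemma le_choquet E F f g : E `<=` F -> (forall x, E x -> f x <= g x) ->
  I E f <= I F g.
Proof.
move=> EF fg; apply: le_choquet_layer => t _; apply: le_hcontent => x [Ex tf].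
by split; [exact: EF|exact: lt_le_trans (fg _ Ex)].
Qed.

Lemma choquetD_null E N g : H N = 0 -> I (E `\` N) g = I E g.
Proof.
move=> N0; apply: eq_integral => t _.
rewrite -(hcontentD_null [set x | E x /\ t%:E < g x] N0); congr hcontent.
by apply/seteqP; split => x /= [[? ?] ?].
Qed.

(** Countable subadditivity in the domain of integration is inherited from the
content, layer by layer. *)
Lemma choquet_sub (T : countType) (D : set T) E (F : T -> set 'rV[R]_n) g :
  E `<=` \bigcup_(i in D) F i -> I E g <= \esum_(i in D) I (F i) g.
Proof.
move=> EF.
pose h (k : nat) t := if pickle_inv k is Some i then
   if i \in D then H [set x | F i x /\ t%:E < g x] else 0 else 0.
have h0 k t : 0 <= h k t.
  by rewrite /h; case: (@pickle_inv T k) => // i; case: ifP => // _; exact: hcontent_ge0.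
have mh k D' : measurable D' -> measurable_fun D' (h k).
  move=> mD'; rewrite /h; case: (@pickle_inv T k) => [i|]; last exact: measurable_cst.
  by case: (i \in D); [exact: measurable_layer|exact: measurable_cst].
rewrite esum_pickle; last by move=> i; exact: choquet_ge0.
rewrite [leRHS](_ : _ =
    \int[lebesgue_measure]_(t in `]0%R, +oo[) \sum_(k <oo) h k t); last first.
  rewrite integral_nneseries//; last by move=> k; exact: mh.
  apply: eq_eseriesr => k _; rewrite /h; case: (@pickle_inv T k) => [i|]; last first.
    by rewrite integral0.
  by case: (i \in D) => //; rewrite integral0.
apply: ge0_le_integral => //.
- by move=> t _; exact: hcontent_ge0.
- exact: measurable_layer.
- by apply: ge0_emeasurable_sum => // k _; exact: mh.
- move=> t _; rewrite -esum_pickle; last by move=> i; exact: hcontent_ge0.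
  by apply: hcontent_sub => x [/EF[i Di Fx] tg]; exists i.
Qed.

Lemma fsum_choquet (T : choiceType) (D : set T) (F : T -> set 'rV[R]_n) g :
  finite_set D ->
  \sum_(i \in D) I (F i) g =
  \int[lebesgue_measure]_(t in `]0%R, +oo[)
    \sum_(i \in D) H [set x | F i x /\ t%:E < g x].
Proof.
move=> finD; rewrite ge0_integral_fsum//.
- by move=> i; exact: measurable_layer.
- by move=> i t _; exact: hcontent_ge0.
Qed.

Lemma choquetZ E g (c : R) : (0 < c)%R -> I E (fun x => c%:E * g x) = c%:E * I E g.
Proof.
move=> c0; rewrite /choquet (ge0_integral_dilate c0)//.
- congr (_ * _); apply: eq_integral => t _; congr hcontent.
  apply/seteqP; split => x /= [Ex]; rewrite EFinM lte_pmul2l//.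
- exact: measurable_layer.
- by move=> t; exact: hcontent_ge0.
Qed.

Lemma choquet_le_bound E g (a : R) : (0 <= a)%R -> (forall x, E x -> g x <= a%:E) ->
  I E g <= a%:E * H E.
Proof.
move=> a0 ga; rewrite -integral_step// ?hcontent_ge0//.
apply: ge0_le_integral => //.
- by move=> t _; exact: hcontent_ge0.
- exact: measurable_layer.
- apply: nonincreasing_emeasurable => // s t st.
  case: ifPn => [ta|_]; last by case: ifP => // _; exact: hcontent_ge0.
  by rewrite (le_lt_trans st ta).
- move=> t _; case: ifPn => [ta|]; first by apply: le_hcontent => x [].
  rewrite -leNgt => at_; rewrite (_ : [set _ | _] = set0) ?hcontent0//.
  apply/seteqP; split => x //= [Ex].
  by apply/negP; rewrite -leNgt (le_trans (ga _ Ex))// lee_fin.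
Qed.

(** Enlarging the domain from E to F adds the layers below b, on which the
content of the domain grows from that of E to that of F. *)
Lemma choquet_growth E F N g (b : R) : E `<=` F -> H N = 0 -> (0 <= b)%R ->
    (forall x, F x -> ~ N x -> b%:E <= g x) ->
  I E g + b%:E * H F <= I F g + b%:E * H E.
Proof.
move=> EF N0 b0 bg.
rewrite -!integral_step// ?hcontent_ge0//.
have mstep A : measurable_fun (`]0%R, +oo[%classic : set (measurableTypeR R))
    (fun t => if (t < b)%R then H A else 0).
  apply: nonincreasing_emeasurable => // s t st.
  case: ifPn => [ta|_]; last by case: ifP => // _; exact: hcontent_ge0.
  by rewrite (le_lt_trans st ta).
have step0 A t : 0 <= if (t < b)%R then H A else 0.
  by case: ifP => // _; exact: hcontent_ge0.
rewrite -!ge0_integralD//; try exact: measurable_layer;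
  try by move=> *; exact: hcontent_ge0.
apply: ge0_le_integral => //.
- by move=> t _; rewrite adde_ge0// hcontent_ge0.
- by apply: emeasurable_funD => //; exact: measurable_layer.
- by apply: emeasurable_funD => //; exact: measurable_layer.
- move=> t _; case: ifPn => [tb|_]; last first.
    by rewrite !adde0 le_hcontent// => x [/EF].
  rewrite addeC leeD//; last by apply: le_hcontent => x [].
  rewrite -(hcontentD_null F N0) le_hcontent// => x [Fx Nx]; split => //.
  by apply: lt_le_trans (bg _ Fx Nx); rewrite lte_fin.
Qed.

Lemma choquet_ge_bound E g (b : R) : (0 <= b)%R -> (forall x, E x -> b%:E <= g x) ->
  b%:E * H E <= I E g.
Proof.
move=> b0 bg; have H0 : H set0 = 0 by exact: hcontent0.
have := @choquet_growth set0 E set0 g b (@sub0set _ _) H0 b0 (fun x Ex _ => bg x Ex).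
rewrite H0 mule0 adde0; apply: le_trans; rewrite leeDr//; exact: choquet_ge0.
Qed.

(** If the integral vanishes then so does the content of every set where g is
bounded below by the inverse of an integer, and these sets exhaust E up to N. *)
Lemma choquet_gt0 E N g : 0 < H E -> H N = 0 ->
  (forall x, E x -> ~ N x -> 0 < g x) -> 0 < I E g.
Proof.
move=> E0 N0 g0; rewrite lt_neqAle choquet_ge0 andbT eq_sym.
apply/eqP => I0; move: E0; rewrite ltNge -N0 => /negP; apply.
rewrite -(hcontentD_null E N0) N0.
pose L (k : nat) := [set x | E x /\ (k.+1%:R^-1)%:E <= g x].
have L0 k : H (L k) = 0.
  apply/eqP; rewrite eq_le hcontent_ge0 andbT.
  have : (k.+1%:R^-1)%:E * H (L k) <= 0.
    rewrite -I0; apply: le_trans (choquet_ge_bound _ (fun x => @proj2 _ _)) _ => //.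
    by apply: le_choquet => x [].
  by rewrite lee_pdivrMl// mule0.
rewrite -(hcontent_null_bigcup L0); apply: le_hcontent => x [Ex Nx].
have := g0 _ Ex Nx; case gx : (g x) => [r| |]//; rewrite ?lte_fin => r0; last first.
  by exists 0%N => //; split => //; rewrite gx leey.
exists (Num.truncn r^-1) => //; split => //; rewrite gx lee_fin.
by rewrite -[leRHS]invrK lef_pV2 ?posrE// ?invr_gt0// ltW// truncnS_gt.
Qed.

End Choquet.

(** * Homogeneity of the content *)

Section Homogeneity.
Variables (R : realType) (n : nat) (d : R).
Implicit Types (E F : set 'rV[R]_n) (a x : 'rV[R]_n) (l : R).
Local Notation H := (@hcontent R n d).

Lemma hcontent_similarity_le a l E F : (0 < l)%R ->
    (forall x, F x -> E (l^-1 *: (x - a))%R) ->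
  H F <= (l `^ d)%:E * H E.
Proof.
move=> l0 FE; pose h x : 'rV[R]_n := (l^-1 *: (x - a))%R.
apply: (@le_trans _ _ (H (h @^-1` E))); first by apply: le_hcontent => x /FE.
apply: (@le_hcontent_of_cubes R n d (fun A => H (h @^-1` A))).
- by rewrite powR_gt0.
- move=> D A B AB; apply: hcontent_sub => x /AB[i Di Bx].
  by exists i.
- move=> b m m0; rewrite -(powRM _ (ltW l0) (ltW m0)).
  have <- : cube (a + l *: b)%R (l * m)%R = h @^-1` cube b m.
    apply/seteqP; split=> x xP i; move: (xP i); rewrite /h !mxE.
      by rewrite ltr_pdivlMl// ler_pdivrMl// => /andP[? ?]; apply/andP; split; lra.
    by rewrite ltr_pdivlMl// ler_pdivrMl// => /andP[? ?]; apply/andP; split; lra.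
  by apply: hcontent_cube_le; rewrite mulr_gt0.
Qed.

(** Translations and dilations identify all cubes, so the content of a cube is
the content of the unit cube times a power of the edge length. *)
Lemma hcontent_cube a l : (0 < l)%R ->
  H (cube a l) = (l `^ d)%:E * H (cube 0%R 1%R).
Proof.
move=> l0; apply/eqP; rewrite eq_le; apply/andP; split.
  apply: (@hcontent_similarity_le a l) => // x xP i; rewrite !mxE.
  move: (xP i) => /andP[? ?].
  by rewrite ltr_pdivlMl// ler_pdivrMl// mulr0 add0r mulr1; apply/andP; split; lra.
rewrite -lee_pdivlMl ?powR_gt0//.
have -> : ((l `^ d)^-1 = l^-1 `^ d)%R by rewrite -powRN -[in RHS]powR_inv1 ?ltW// -powRrM mulN1r.
apply: (@hcontent_similarity_le (- (l^-1 *: a))%R); rewrite ?invr_gt0// => x xP i.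
move: (xP i); rewrite !mxE invrK add0r => /andP[x0 x1].
rewrite mulrDr opprK mulrA divff ?gt_eqF// mul1r.
have : (0 < l * x ord0 i)%R by rewrite mulr_gt0.
have : (l * x ord0 i <= l)%R by rewrite ger_pMr.
by move=> ? ?; apply/andP; split; lra.
Qed.

End Homogeneity.

(** * Dyadic cubes *)

(** The pair (k, z) stands for the cube of edge length 2 ^ k whose upper corner
is 2 ^ k times z. *)
Notation dyadic n := (int * 'rV[int]_n)%type.

Section Dyadic.
Variables (R : realType) (n : nat).
Implicit Types (P Q : dyadic n) (x : 'rV[R]_n) (F : set (dyadic n)).
Local Open Scope ring_scope.

Definition side P : R := 2 ^ P.1.

Definition dyadic_at (k : int) x : dyadic n :=
  (k, \row_i Num.ceil (x ord0 i / 2 ^ k)).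

(** Membership is a statement about indices, so that the inclusion of a dyadic cube
in its parent and the nestedness of dyadic cubes reduce to computations with
[dyadic_at]. *)
Definition dcube P : set 'rV[R]_n := [set x | dyadic_at P.1 x = P].

(** The union of a dyadic cube with its neighbours. *)
Definition dilate P : set 'rV[R]_n :=
  cube (\row_i (side P * (P.2 ord0 i - 2)%:~R)) (3 * side P).

Definition parent P : dyadic n := (P.1 + 1, \row_i ((P.2 ord0 i + 1) %/ 2)%Z).

Definition ancestor j P := iter j parent P.

Definition below P Q := exists j, ancestor j P = Q.

Definition maximal_dyadic F : set (dyadic n) :=
  [set P | F P /\ forall Q, F Q -> below P Q -> Q = P].

Lemma side_gt0 P : 0 < side P.
Proof. by rewrite exprz_gt0. Qed.

Lemma side_parent P : side (parent P) = 2 * side P.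
Proof. by rewrite /side/= expfzDr// mulrC. Qed.

Lemma dcubeE P : dcube P = cube (\row_i (side P * (P.2 ord0 i - 1)%:~R)) (side P).
Proof.
have s0 := side_gt0 P.
apply/seteqP; split => x.
  move=> xP i; have /andP[] := ceil_itv (x ord0 i / 2 ^ P.1).
  have -> : Num.ceil (x ord0 i / 2 ^ P.1) = P.2 ord0 i by rewrite -xP/= mxE.
  rewrite -/(side P) ltr_pdivlMr// ler_pdivrMr// !mxE intrB => ? ?.
  by apply/andP; split; lra.
move=> xP; case: P s0 xP => k z s0 xP; congr pair; apply/rowP => i; rewrite mxE.
apply/eqP; rewrite ceil_eq; move: (xP i); rewrite !mxE/= -/(side (k, z)).
rewrite ltr_pdivlMr// ler_pdivrMr// intrB => /andP[? ?].
by apply/andP; split; lra.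
Qed.

Lemma dilateP P x :
  dilate P x <-> forall i, (`|(dyadic_at P.1 x).2 ord0 i - P.2 ord0 i| <= 1).
Proof.
have s0 := side_gt0 P.
split => xP i; move: (xP i); rewrite !mxE -/(side P).
  set c := Num.ceil _ => /andP[lo hi].
  have : c <= P.2 ord0 i + 1.
    by rewrite ceil_le_int ler_pdivrMr// intrD; move: hi; rewrite intrB; lra.
  have : P.2 ord0 i - 2 < c by rewrite ceil_gt_int ltr_pdivlMr// mulrC.
  lia.
set c := Num.ceil _ => cP.
have : c <= P.2 ord0 i + 1 by lia.
rewrite ceil_le_int ler_pdivrMr// intrD => hi.
have : P.2 ord0 i - 2 < c by lia.
rewrite ceil_gt_int ltr_pdivlMr// mulrC => lo; rewrite lo/=.
by move: hi; rewrite intrB; lra.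
Qed.

Lemma dcube_dilate P : dcube P `<=` dilate P.
Proof. by move=> x xP; apply/dilateP => i; rewrite xP subrr. Qed.

(** This is why dyadic cubes are nested: the index at one scale determines the
index at the next one. *)
Lemma ceil_half (u : R) : Num.ceil (u / 2) = ((Num.ceil u + 1) %/ 2)%Z.
Proof.
have E j : (Num.ceil (u / 2) <= j) = (((Num.ceil u + 1) %/ 2)%Z <= j).
  rewrite ceil_le_int ler_pdivrMr// (_ : j%:~R * 2 = (j * 2)%:~R); last by rewrite intrM.
  by rewrite -ceil_le_int; move: (Num.ceil u) => c; apply/idP/idP; lia.
by apply/eqP; rewrite eq_le E lexx -E lexx.
Qed.

Lemma parent_dyadic_at k x : parent (dyadic_at k x) = dyadic_at (k + 1) x.
Proof.
congr pair; apply/rowP => i; rewrite !mxE -ceil_half; congr Num.ceil.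
by rewrite expfzDr// invfM mulrA.
Qed.

Lemma dcube_parent P : dcube P `<=` dcube (parent P).
Proof. by move=> x xP; rewrite /dcube/= -[in RHS]xP parent_dyadic_at. Qed.

Lemma dilate_parent P : dilate P `<=` dilate (parent P).
Proof.
move=> x /dilateP xP; apply/dilateP => i; move: (xP i).
by rewrite -parent_dyadic_at !mxE; lia.
Qed.

Lemma ancestor_dyadic_at j k x : ancestor j (dyadic_at k x) = dyadic_at (k + j%:Z) x.
Proof.
elim: j => [|j IH]; first by rewrite addr0.
by rewrite /ancestor iterS -/(ancestor j _) IH parent_dyadic_at -addrA; congr dyadic_at; lia.
Qed.

Lemma ancestorS j P : ancestor j.+1 P = parent (ancestor j P).
Proof. by []. Qed.

Lemma below_refl P : below P P. Proof. by exists 0%N. Qed.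

Lemma below_trans P Q S : below P Q -> below Q S -> below P S.
Proof. by move=> [i <-] [j <-]; exists (j + i)%N; rewrite /ancestor iterD. Qed.

Lemma below_total P Q S : below P Q -> below P S -> below Q S \/ below S Q.
Proof.
move=> [i <-] [j <-]; have [ij|/ltnW ji] := leqP i j; [left|right].
  by exists (j - i)%N; rewrite /ancestor -iterD subnK.
by exists (i - j)%N; rewrite /ancestor -iterD subnK.
Qed.

Lemma below_dcube P Q : below P Q -> dcube P `<=` dcube Q.
Proof.
move=> [j <-]; elim: j => // j IH.
by rewrite ancestorS; apply: subset_trans IH _; exact: dcube_parent.
Qed.

Lemma below_dilate P Q : below P Q -> dilate P `<=` dilate Q.
Proof.
move=> [j <-]; elim: j => // j IH.
by rewrite ancestorS; apply: subset_trans IH _; exact: dilate_parent.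
Qed.

Lemma below_side P Q : below P Q -> side P <= side Q.
Proof.
move=> [j <-]; elim: j => // j IH; rewrite ancestorS side_parent.
by have := side_gt0 (ancestor j P); lra.
Qed.

Lemma dcube_nested P Q x : dcube P x -> dcube Q x -> below P Q \/ below Q P.
Proof.
have above (S T : dyadic n) : dcube S x -> dcube T x -> S.1 <= T.1 -> below S T.
  move=> xS xT le_ST; have [j Tj] : exists j : nat, T.1 = S.1 + j%:Z.
    by exists `|T.1 - S.1|%N; lia.
  by exists j; rewrite -xS ancestor_dyadic_at -Tj.
move=> xP xQ; have [le_PQ|/ltW le_QP] := leP P.1 Q.1; [left|right]; exact: above.
Qed.

Lemma maximal_dyadic_eq F P Q : maximal_dyadic F P -> maximal_dyadic F Q ->
  below P Q \/ below Q P -> P = Q.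
Proof. by move=> [FP maxP] [FQ maxQ] [/maxP-> //|/maxQ-> //]. Qed.

(** The ancestors of P form a single chain, so the last one that belongs to F is
maximal. *)
Lemma exists_maximal_dyadic F P : F P ->
    (exists N, forall j, (N <= j)%N -> ~ F (ancestor j P)) ->
  exists2 Q, maximal_dyadic F Q & below P Q.
Proof.
move=> FP [N FN].
have ex : exists j, `[< F (ancestor j P) >] by exists 0%N; apply/asboolP.
have ub j : `[< F (ancestor j P) >] -> (j <= N)%N.
  by move=> /asboolP Fj; rewrite leqNgt; apply/negP => /ltnW/FN.
case: (ex_maxnP ex ub) => j /asboolP Fj maxj; exists (ancestor j P); last by exists j.
split=> // Q FQ [i Qi].
have : (i + j <= j)%N.
  apply: maxj; apply/asboolP; rewrite /ancestor iterD.
  by move: Qi; rewrite /ancestor => ->.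
by rewrite -[X in (_ <= X)%N]add0n leq_add2r leqn0 => /eqP i0; rewrite -Qi i0.
Qed.

Lemma dyadic_scale (l : R) : 0 < l -> exists k : int, (2 : R) ^ k / 2 < l <= 2 ^ k.
Proof.
move=> l0; have ln2_gt0 : 0 < ln (2 : R) by rewrite ln_gt0// ltr1n.
pose k := Num.ceil (ln l / ln 2); exists k.
have /andP[] := ceil_itv (ln l / ln 2); rewrite -/k ltr_pdivlMr// ler_pdivrMr// => lo hi.
have two : (2 : R) \is Num.pos by rewrite posrE.
have expk (j : int) : (2 : R) ^ j = expR (j%:~R * ln 2).
  by rewrite -powR_intmul// /powR gt_eqF.
rewrite -(@lnK _ l) ?posrE//; apply/andP; split; last by rewrite expk ler_expR.
rewrite (_ : _ / 2 = expR ((k - 1)%:~R * ln 2)) ?ltr_expR//.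
by rewrite -expk expfzDr.
Qed.

(** At the first dyadic scale not smaller than l, each coordinate of a point of the
cube has one of two consecutive indices; this gives the 2 ^ n dyadic cubes, and
any two of them are neighbours or equal. *)
Lemma cube_dyadic_cover (a : 'rV[R]_n) (l : R) : 0 < l ->
  exists s : seq (dyadic n), [/\ size s = (2 ^ n)%N,
    forall x, cube a l x -> exists2 P, P \in s & dcube P x &
    forall P, P \in s -> cube a l `<=` dilate P /\ side P <= 2 * l].
Proof.
move=> l0; have [k /andP[kl lk]] := dyadic_scale l0.
have s0 : 0 < (2 : R) ^ k by rewrite exprz_gt0.
pose m i := Num.floor (a ord0 i / 2 ^ k) + 1.
pose P (e : {ffun 'I_n -> bool}) : dyadic n := (k, \row_i (m i + (e i : nat)%:Z)).
have xm x i : cube a l x ->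
    m i <= (dyadic_at k x).2 ord0 i <= m i + 1.
  move=> /(_ i) /andP[lo hi]; rewrite mxE; apply/andP; split.
    rewrite /m -ltzD1 ltrD2r floor_lt_int.
    have := ceil_ge (x ord0 i / 2 ^ k); apply: lt_le_trans.
    by rewrite ltr_pM2r// invr_gt0.
  rewrite ceil_le_int ler_pdivrMr// intrD.
  have /ltW := floorD1_gt (a ord0 i / 2 ^ k).
  by rewrite ler_pdivrMr// -/(m i) mulrDl mul1r; lra.
exists [seq P e | e : {ffun 'I_n -> bool}]; split.
- by rewrite size_image card_ffun card_bool card_ord.
- move=> x xQ.
  pose e := [ffun i => (dyadic_at k x).2 ord0 i == m i + 1].
  exists (P e); first by rewrite map_f// mem_enum.
  congr pair; apply/rowP => i; have := xm x i xQ.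
  by rewrite !mxE ffunE mxE; set c := Num.ceil _; case: (eqVneq c) => /=; lia.
- move=> _ /mapP[e _ ->]; split; last by rewrite /side/=; lra.
  move=> x xQ; apply/dilateP => i; have := xm x i xQ; rewrite [(P e).2 _ _]mxE.
  by case: (e i) => /=; lia.
Qed.

End Dyadic.

Arguments below {n} P Q.

(** * Packing families of dyadic cubes *)

Section Packing.
Variables (R : realType) (n : nat) (d : R).
Hypothesis d0 : (0 < d)%R.
Implicit Types (P Q : dyadic n) (F S : set (dyadic n)) (E : set 'rV[R]_n) (x : 'rV[R]_n).
Local Notation H := (@hcontent R n d).
Local Notation I := (@choquet R n d).

Definition weight P : R := (side R P `^ d)%R.

Definition family_weight S Q : \bar R :=
  \esum_(P in S `&` below^~ Q) (weight P)%:E.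

Definition packing S := forall Q, family_weight S Q <= (2 * weight Q)%:E.

Lemma weight_gt0 P : (0 < weight P)%R.
Proof. by rewrite powR_gt0// side_gt0. Qed.

Lemma weight_ge0 P : 0 <= (weight P)%:E.
Proof. by rewrite lee_fin ltW// weight_gt0. Qed.

Lemma weight_below P Q : below P Q -> (weight P <= weight Q)%R.
Proof.
by move=> PQ; rewrite ge0_ler_powR ?nnegrE ?(ltW (side_gt0 _ _))// ?(ltW d0)// below_side.
Qed.

Lemma hcontent_dcube_le P : H (dcube P) <= (weight P)%:E.
Proof. by rewrite dcubeE; apply: hcontent_cube_le; exact: side_gt0. Qed.

(** Sums over S are suprema of finite sums, so this is what makes the packing
condition pass to the union of a chain of families. *)
Lemma chain_finite_sub (T : choiceType) (A : set (set T)) (X : set T) :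
    total_on A subset -> finite_set X -> X `<=` \bigcup_(C in A) C ->
  X = set0 \/ exists2 C, A C & X `<=` C.
Proof.
move=> totA /finite_seqP[s ->].
elim: s => [_|x s IH sU]; first by left; apply/seteqP; split.
right; have [C AC Cx] := sU x (mem_head _ _).
have /IH[s0|[C' AC' sC']] : [set` s] `<=` \bigcup_(C in A) C.
- by move=> y ys; apply: sU; rewrite /= inE (_ : y \in s) ?orbT.
- exists C => // y; rewrite /= inE => /predU1P[->//|ys].
  by have : [set` s] y by []; rewrite s0.
- have [CC'|C'C] := totA _ _ AC AC'.
    by exists C' => // y; rewrite /= inE => /predU1P[->|/sC'//]; exact: CC'.
  by exists C => // y; rewrite /= inE => /predU1P[->//|/sC'/C'C].
Qed.

(** A maximal packing subfamily S of F controls all of F: a member P of F that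
was not selected would overload some dyadic cube Q above P, and P itself weighs
at most as much as Q, so that Q already carries its own weight in S. *)
Lemma packing_selection F : exists S, [/\ S `<=` F, packing S &
  forall P, F P -> exists2 Q, below P Q & (weight Q)%:E <= family_weight S Q].
Proof.
have [|S [[SF packS] maxS]] :=
    @Zorn_bigcup _ [set S | S `<=` F /\ packing S].
  move=> A AP totA; split; first by move=> P [C /AP[CF _] /CF].
  move=> Q; apply: esum_le_fsum => X finX XU.
  have XU' : X `<=` \bigcup_(C in A) C by move=> P /XU[].
  have [->|[C AC XC]] := chain_finite_sub totA finX XU'.
    by rewrite fsbig_set0 lee_fin mulr_ge0// ltW// weight_gt0.
  apply: le_trans ((AP _ AC).2 Q); apply: fsum_le_esum => // P XP.
  by split; [exact: XC|exact: (XU _ XP).2].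
exists S; split=> // P FP.
have [SP|nSP] := pselect (S P).
  exists P; first exact: below_refl.
  rewrite -(@esum_set1 R _ P (fun P => (weight P)%:E)) ?weight_ge0//.
  by apply: sub_esum => _ ->; split => //; exact: below_refl.
have : ~ packing (P |` S).
  move=> packPS; apply: (maxS (P |` S)).
    by split; [exact: subsetUr|move=> /(_ P (or_introl erefl))].
  by split=> // Q [->//|/SF].
move=> /existsNP[Q /negP]; rewrite -ltNge => overQ.
have PS_le : family_weight (P |` S) Q <= (weight P)%:E + family_weight S Q.
  rewrite /family_weight (esumID [set P])/=; last by move=> *; exact: weight_ge0.
  apply: leeD.
    rewrite -(@esum_set1 R _ P (fun P => (weight P)%:E)) ?weight_ge0//.
    by apply: sub_esum => Q' [].
  by apply: sub_esum => Q' /= [[[//|SQ'] bQ'] _].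
have PQ : below P Q.
  apply: contrapT => nPQ; move: overQ; rewrite ltNge => /negP; apply.
  by apply: le_trans (packS Q); apply: sub_esum => Q' /= [[->|SQ'] bQ'].
exists Q => //.
have : (2 * weight Q)%:E < (weight Q)%:E + family_weight S Q.
  by apply: lt_le_trans overQ _; apply: le_trans PS_le _; rewrite leeD2r// lee_fin weight_below.
rewrite mulrDl mul1r EFinD => /ltW.
by rewrite leeD2lE.
Qed.

Definition disjoint_family S := forall P Q, S P -> S Q -> below P Q -> P = Q.

Lemma disjoint_family_eq S P Q x : disjoint_family S -> S P -> S Q ->
  dcube P x -> dcube Q x -> P = Q.
Proof.
move=> disj SP SQ xP xQ; have [PQ|QP] := dcube_nested xP xQ; first exact: disj.
by apply/esym; exact: disj.
Qed.

(** Either a member of S contains Q and is the only one that meets Q, or the members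
of S that meet Q lie below Q and the packing condition applies. *)
Lemma packing_dcube S Q : disjoint_family S -> packing S ->
  \esum_(P in S) H (dcube Q `&` dcube P) <= (2 * weight Q)%:E.
Proof.
move=> disj packS.
have far P : ~ (exists x : 'rV[R]_n, (dcube Q `&` dcube P) x) -> H (dcube Q `&` dcube P) = 0.
  move=> nx; rewrite (_ : _ `&` _ = set0) ?hcontent0//.
  by apply/seteqP; split => // x xQP; apply: nx; exists x.
have [[P0 SP0 QP0]|noabove] := pselect (exists2 P0, S P0 & below Q P0).
  rewrite (esumID [set P0])/=; last by move=> *; exact: hcontent_ge0.
  rewrite [X in _ + X]esum1 ?adde0; last first.
    move=> P [SP /= PP0]; apply: far => -[x [xQ xP]]; apply: PP0.
    exact: (disjoint_family_eq disj SP SP0 xP (below_dcube QP0 xQ)).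
  have -> : S `&` [set P0] = [set P0] by apply/seteqP; split => [P []|_ ->].
  rewrite esum_set1 ?hcontent_ge0//.
  apply: (@le_trans _ _ (H (dcube Q))); first by apply: le_hcontent; exact: subIsetl.
  apply: le_trans (hcontent_dcube_le _) _; rewrite lee_fin.
  by have := weight_gt0 Q; lra.
rewrite (esumID (below^~ Q))/=; last by move=> *; exact: hcontent_ge0.
rewrite [X in _ + X]esum1 ?adde0; last first.
  move=> P [SP /= nPQ]; apply: far => -[x [xQ xP]].
  by have [QP|//] := dcube_nested xQ xP; apply: noabove; exists P.
apply: le_trans (packS Q); apply: le_esum => P _.
by apply: le_trans (hcontent_dcube_le P); apply: le_hcontent; exact: subIsetr.
Qed.

(** A cube of edge length l is covered by 2 ^ n dyadic cubes of edge length at most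
2 l, and each of them receives at most twice its weight. *)
Definition packing_const : R := ((2 ^ n)%:R * (2 * 2 `^ d))%R.

Lemma packing_const_gt0 : (0 < packing_const)%R.
Proof. by rewrite mulr_gt0// ?ltr0n ?expn_gt0// mulr_gt0// powR_gt0. Qed.

(** Along a disjoint packing family the content is additive up to a constant:
the sum of the contents of the pieces is countably subadditive, and a cube is
covered by boundedly many dyadic cubes of comparable size, on which the packing
condition bounds that sum. *)
Lemma packing_hcontent S E : disjoint_family S -> packing S ->
  \esum_(P in S) H (E `&` dcube P) <= packing_const%:E * H E.
Proof.
move=> disj packS.
apply: (@le_hcontent_of_cubes R n d (fun E => \esum_(P in S) H (E `&` dcube P))).
- exact: packing_const_gt0.
- move=> D A B AB; rewrite exchange_esum; last by move=> *; exact: hcontent_ge0.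
  apply: le_esum => P _; apply: hcontent_sub => x [/AB[i Di Bx] xP].
  by exists i.
move=> a l l0; have [s [size_s covs s_le]] := @cube_dyadic_cover R n a l l0.
apply: (@le_trans _ _
    (\esum_(P in S) \esum_(Q in [set` s]) H (dcube Q `&` dcube P))).
  apply: le_esum => P _; apply: hcontent_sub => x [/covs[Q sQ xQ] xP].
  by exists Q.
rewrite exchange_esum; last by move=> *; exact: hcontent_ge0.
rewrite /packing_const -mulrA -size_s; apply: esum_seq_le.
  by rewrite -mulrA mulr_ge0// mulr_ge0// powR_ge0.
move=> Q /s_le[_ Ql]; apply: le_trans (packing_dcube _ disj packS) _.
rewrite lee_fin -mulrA ler_pM2l// -powRM ?(ltW l0)//.
by rewrite ge0_ler_powR ?nnegrE ?(ltW d0) ?(ltW (side_gt0 _ _))// mulr_ge0// ltW.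
Qed.

(** The previous bound integrated over the layers of g. *)
Lemma packing_choquet S g : disjoint_family S -> packing S ->
  \esum_(P in S) I (dcube P) g <= packing_const%:E * I setT g.
Proof.
move=> disj packS; apply: esum_le_fsum => X finX XS; rewrite fsum_choquet//.
rewrite /choquet -ge0_integralZl//; last 3 first.
- exact: measurable_layer.
- by move=> t _; exact: hcontent_ge0.
- by rewrite lee_fin ltW// packing_const_gt0.
apply: ge0_le_integral => //.
- by move=> t _; apply: fsume_ge0 => P _; exact: hcontent_ge0.
- by apply: emeasurable_fsum => // P; exact: measurable_layer.
- by apply: measurable_funeM; exact: measurable_layer.
move=> t _; apply: le_trans (packing_hcontent _ disj packS).
apply: le_trans (fsum_le_esum _ finX XS).
apply: lee_fsum => // P _; apply: le_hcontent => x [xP tg]; split=> //.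
Qed.

End Packing.

(** * A1 weights satisfy the weak type inequality *)

(** The proportionality factor in the content of cubes. *)
Definition unit_content (R : realType) (n : nat) (d : R) : R :=
  fine (hcontent d (cube (0 : 'rV[R]_n)%R 1%R)).

Section Weights.
Variables (R : realType) (n : nat) (d : R) (w : 'rV[R]_n -> \bar R).
Hypothesis d0 : (0 < d)%R.
Hypothesis w_weight : capacitary_weight d w.
Hypothesis unit_gt0 : 0 < hcontent d (cube (0 : 'rV[R]_n)%R 1%R).
Implicit Types (P Q : dyadic n) (F S : set (dyadic n)) (x a : 'rV[R]_n) (l : R).
Implicit Types (f : 'rV[R]_n -> \bar R).
Local Notation H := (@hcontent R n d).
Local Notation I := (@choquet R n d).
Local Notation wt := (weight d).

Local Notation c1 := (@unit_content R n d).

Lemma hcontent_unit : H (cube 0%R 1%R) = c1%:E.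
Proof.
rewrite /unit_content fineK// ge0_fin_numE ?hcontent_ge0//.
by apply: le_lt_trans (hcontent_cube_le d 0%R ltr01) _; rewrite ltey.
Qed.

Lemma unit_content_gt0 : (0 < c1)%R.
Proof. by rewrite -lte_fin -hcontent_unit. Qed.

Lemma hcontent_cubeE a l : (0 < l)%R -> H (cube a l) = (l `^ d * c1)%:E.
Proof. by move=> l0; rewrite hcontent_cube// hcontent_unit. Qed.

Lemma hcontent_dcubeE P : H (dcube P) = (wt P * c1)%:E.
Proof. by rewrite dcubeE hcontent_cubeE// side_gt0. Qed.

Lemma w_ge0 x : 0 <= w x. Proof. by case: w_weight. Qed.

Lemma wcontent_cube_fin a l : I (cube a l) w \is a fin_num.
Proof.
rewrite ge0_fin_numE ?choquet_ge0//.
pose B : set 'rV[R]_n := [set x | forall i, `[a ord0 i, (a ord0 i + l)%R]%classic (x ord0 i)].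
have cB : compact B.
  apply: (@rV_compact R n (fun i => `[a ord0 i, (a ord0 i + l)%R]%classic)) => i.
  exact: segment_compact.
case: w_weight => _ /(_ _ cB) + _; apply: le_lt_trans.
apply: le_choquet => [x xQ i|x _]; last by rewrite gee0_abs// w_ge0.
by have /andP[/ltW ? ?] := xQ i; rewrite /= in_itv/=; apply/andP.
Qed.

(** One exceptional set N serves for all cubes, so that it is removed from a domain
of integration once and for all. *)
Definition A1_on_cubes (K : R) (N : set 'rV[R]_n) := forall a l x,
  (0 < l)%R -> cube a l x -> ~ N x -> I (cube a l) w <= (K * l `^ d)%:E * w x.

Lemma A1_cubes : A1 d w -> exists K N, [/\ (0 < K)%R, H N = 0 & A1_on_cubes K N].
Proof.
move=> [K [K0 [N [N0 NP]]]]; exists (K * c1)%R, N; split=> //.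
  by rewrite mulr_gt0// unit_content_gt0.
move=> a l x l0 Qx Nx.
have h0 : (0 < l `^ d * c1)%R by rewrite mulr_gt0 ?unit_content_gt0// powR_gt0.
have : (H (cube a l))^-1 * I (cube a l) (fun y => `|w y|) <= K%:E * w x.
  apply: le_trans (NP x Nx); rewrite /maximal; apply: ereal_sup_ubound.
  by exists (cube a l) => //; split=> //; exists a, l.
rewrite hcontent_cubeE// inver gt_eqF// lee_pdivrMl// muleA -EFinM.
rewrite (_ : I _ (fun y => `|w y|) = I (cube a l) w); last first.
  by congr choquet; apply/funext => y; rewrite gee0_abs// w_ge0.
by rewrite (_ : (K * c1 * l `^ d)%R = (l `^ d * c1 * K)%R)//; ring.
Qed.

Section A1Weights.
Variables (K : R) (N : set 'rV[R]_n).
Hypotheses (K0 : (0 < K)%R) (N0 : H N = 0) (A1w : A1_on_cubes K N).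

(** From one ancestor to the next the content of the cube grows by the factor
2 ^ d, while by the A1 condition the weight on it is almost everywhere at least a
constant multiple of the inverse of that content; hence each generation adds a
fixed amount to the weighted content. *)
Lemma wcontent_ancestor_unbounded P (A : R) :
  exists m, forall j, (m <= j)%N -> A%:E < I (dcube (ancestor j P)) w.
Proof.
pose D j : set 'rV[R]_n := dcube (ancestor j P).
pose u j : R := fine (I (D j) w).
have uE j : I (D j) w = (u j)%:E by rewrite fineK// /D dcubeE wcontent_cube_fin.
have D_sub j : D j `<=` D j.+1 by exact: dcube_parent.
have u_ge j : (u 0%N <= u j)%R.
  by rewrite -lee_fin -!uE; apply: le_choquet => //; apply: below_dcube; exists j.
have u0 : (0 < u 0%N)%R.
  rewrite -lte_fin -uE.
  have [_ _ [N' [N'0 N'P]]] := w_weight.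
  apply: choquet_gt0 N'0 _ => [|x _ /N'P/andP[]//].
  by rewrite hcontent_dcubeE lte_fin mulr_gt0 ?unit_content_gt0// weight_gt0.
have wtS j : wt (ancestor j.+1 P) = (2 `^ d * wt (ancestor j P))%R.
  by rewrite /weight ancestorS side_parent powRM// ltW// side_gt0.
pose e := (u 0%N / K * c1 * (1 - (2 `^ d)^-1))%R.
have e0 : (0 < e)%R.
  rewrite !mulr_gt0 ?invr_gt0 ?unit_content_gt0// subr_gt0 invf_lt1 ?powR_gt0//.
  have : (1 `^ d < 2 `^ d :> R)%R by rewrite gt0_ltr_powR ?nnegrE// ltr1n.
  by rewrite powR1.
have step j : (u j + e <= u j.+1)%R.
  pose W := wt (ancestor j P).
  have W0 : (0 < W)%R by exact: weight_gt0.
  (* The lower bound for w on the next ancestor given by the A1 condition. *)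
  pose b := (u 0%N / (K * (2 `^ d * W)))%R.
  have KW0 : (0 < K * (2 `^ d * W))%R by rewrite !mulr_gt0// powR_gt0.
  have b0 : (0 <= b)%R by rewrite divr_ge0 ?mulr_ge0 ?powR_ge0// ltW.
  have bw x : D j.+1 x -> ~ N x -> b%:E <= w x.
    move=> Dx Nx; rewrite /b mulrC EFinM lee_pdivrMl//.
    apply: (@le_trans _ _ (I (D j.+1) w)); first by rewrite uE lee_fin.
    move: Dx; rewrite /D -wtS /weight dcubeE => Dx.
    by apply: A1w => //; exact: side_gt0.
  have := choquet_growth (@D_sub j) N0 b0 bw.
  rewrite !uE /D !hcontent_dcubeE wtS -/W -!EFinM -!EFinD lee_fin.
  have -> : (b * (2 `^ d * W * c1) = u 0%N / K * c1)%R.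
    by rewrite /b; field; rewrite !gt_eqF// powR_gt0.
  have -> : (b * (W * c1) = u 0%N / K * c1 * (2 `^ d)^-1)%R.
    by rewrite /b; field; rewrite !gt_eqF// powR_gt0.
  by rewrite /e mulrBr mulr1; lra.
have ulin j : (j%:R * e <= u j)%R.
  elim: j => [|j IH]; first by rewrite mul0r ltW.
  by apply: le_trans (step j); rewrite -natr1 mulrDl mul1r lerD2r.
exists (Num.truncn (A / e)).+1 => j mj; rewrite uE lte_fin.
apply: lt_le_trans (ulin j); rewrite -ltr_pdivrMr//.
by apply: lt_le_trans (truncnS_gt _) _; rewrite ler_nat.
Qed.

Lemma exists_maximal_of_bounded F (A : \bar R) : A < +oo ->
    (forall P, F P -> I (dilate P) w <= A) ->
  forall P, F P -> exists2 Q, maximal_dyadic F Q & below P Q.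
Proof.
move=> Ay FA P FP; apply: exists_maximal_dyadic => //.
have [m mP] := wcontent_ancestor_unbounded P (fine A).
have Afin : A \is a fin_num.
  by rewrite ge0_fin_numE//; apply: le_trans (FA _ FP); exact: choquet_ge0.
exists m => j /mP + /FA; rewrite fineK// => lt_A le_A.
have := lt_le_trans lt_A (le_choquet _ (@dcube_dilate R n (ancestor j P)) (fun _ _ => lexx _)).
by rewrite ltNge le_A.
Qed.

(** By the A1 condition w is, almost everywhere on Q, at least a constant times the
weighted content of the dilate divided by the weight of Q. Hence on a member P of
S below Q the integral of |f| w is at least that constant lower bound times
tau times the weight of P, and the weights of these P sum up to the weight of Q. *)
Lemma wcontent_dilate_le S Q f (tau : R) : (0 < tau)%R ->
    (forall P, S P -> (tau * wt P)%:E <= I (dcube P) (fun y => `|f y|)) ->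
    (wt Q)%:E <= family_weight d S Q ->
  I (dilate Q) w <= (K * 3 `^ d / tau)%:E *
    \esum_(P in S `&` below^~ Q) I (dcube P) (fun y => `|f y| * w y).
Proof.
move=> tau0 Sf SQ; set X := (X in _ <= _ * X).
have W0 : (0 < wt Q)%R by exact: weight_gt0.
have s0 : (0 < side R Q)%R by exact: side_gt0.
pose B := fine (I (dilate Q) w).
have BE : I (dilate Q) w = B%:E by rewrite fineK// wcontent_cube_fin.
have X0 : 0 <= X by apply: esum_ge0 => P _; exact: choquet_ge0.
have C0 : (0 < K * 3 `^ d)%R by rewrite mulr_gt0// powR_gt0.
have : 0 <= B%:E by rewrite -BE choquet_ge0.
rewrite BE le_eqVlt => /predU1P[<-|B0]; first by rewrite mule_ge0// lee_fin ltW// divr_gt0.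
rewrite lte_fin in B0.
(* B <= K 3 ^ d (weight Q) w almost everywhere on P, times |f| and integrated. *)
have piece P : S P -> below P Q ->
    (B * tau)%:E * (wt P)%:E <= (K * 3 `^ d * wt Q)%:E * I (dcube P) (fun y => `|f y| * w y).
  move=> SP PQ; rewrite -EFinM -[(B * tau * _)%R]mulrA [in leLHS]EFinM.
  apply: (@le_trans _ _ (B%:E * I (dcube P) (fun y => `|f y|))).
    by rewrite lee_pmul2l//; exact: Sf.
  rewrite -!choquetZ ?mulr_gt0 ?powR_gt0//.
  rewrite -(choquetD_null (dcube P) _ N0) -[leRHS](choquetD_null (dcube P) _ N0).
  apply: le_choquet => // x [Px Nx].
  rewrite [`|f x| * _]muleC muleA; apply: lee_wpmul2r => //.
  rewrite -BE; have := A1w _ (below_dilate PQ (dcube_dilate Px)) Nx.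
  by rewrite powRM ?(ltW s0)// mulrA; apply; rewrite mulr_gt0.
have : (B * tau)%:E * (wt Q)%:E <= (K * 3 `^ d * wt Q)%:E * X.
  apply: (@le_trans _ _ ((B * tau)%:E * family_weight d S Q)).
    by rewrite lee_pmul2l// ?lte_fin ?mulr_gt0.
  have Bt : (0 <= B * tau)%R by rewrite ltW// mulr_gt0.
  have CW : (0 <= K * 3 `^ d * wt Q)%R by rewrite ltW// mulr_gt0.
  rewrite /family_weight -(esumZl _ Bt); last by move=> P; rewrite weight_ge0.
  rewrite -(esumZl _ CW); last by move=> P; exact: choquet_ge0.
  by apply: le_esum => P [SP PQ]; exact: piece.
have k0 : 0 <= ((tau * wt Q)^-1)%:E by rewrite lee_fin invr_ge0 ltW// mulr_gt0.
move=> /(lee_wpmul2l k0); rewrite !muleA -!EFinM.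
have -> : ((tau * wt Q)^-1 * (B * tau) * wt Q = B)%R by field; rewrite !gt_eqF.
have -> // : ((tau * wt Q)^-1 * (K * 3 `^ d * wt Q) = K * 3 `^ d / tau)%R.
by field; rewrite !gt_eqF.
Qed.

Definition heavy f (tau : R) : set (dyadic n) :=
  [set P | (tau * wt P)%:E < I (dcube P) (fun y => `|f y|)].

(** A cube on which the mean of f exceeds t is covered by boundedly many dyadic
cubes of comparable size, one of which must then carry a comparable mean. *)
Lemma maximal_gt_heavy f (t : R) x : (0 < t)%R -> t%:E < maximal d f x ->
  exists2 P, heavy f (c1 / ((2 ^ n)%:R * 2 `^ d) * t) P & dilate P x.
Proof.
move=> t0 /ereal_sup_gt[_ [Q [[a [l [l0 QE]]] Qx] <-]]; subst Q.
set tau := (_ * t)%R.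
have tau0 : (0 < tau)%R.
  by rewrite mulr_gt0 ?divr_gt0 ?mulr_gt0 ?unit_content_gt0 ?powR_gt0// ltr0n expn_gt0.
have h0 : (0 < l `^ d * c1)%R by rewrite mulr_gt0 ?unit_content_gt0// powR_gt0.
rewrite hcontent_cubeE// inver gt_eqF// lte_pdivlMl// => mean_gt.
have [s [size_s covs s_le]] := @cube_dyadic_cover R n a l l0.
apply: contrapT => none; move: mean_gt; rewrite ltNge => /negP; apply.
apply: (@le_trans _ _ (\esum_(P in [set` s]) I (dcube P) (fun y => `|f y|))).
  by apply: choquet_sub => y /covs[P sP Py]; exists P.
apply: (@le_trans _ _ ((size s)%:R * (tau * (2 `^ d * l `^ d)))%:E).
  apply: esum_seq_le => [|P sP]; first by rewrite mulr_ge0 ?(ltW tau0)// mulr_ge0// powR_ge0.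
  have [QP Pl] := s_le P sP.
  apply: (@le_trans _ _ (tau * wt P)%:E).
    by rewrite leNgt; apply/negP => heavyP; apply: none; exists P => //; exact: QP.
  rewrite lee_fin ler_pM2l// -powRM ?(ltW l0)//.
  by rewrite ge0_ler_powR ?nnegrE ?(ltW d0) ?(ltW (side_gt0 _ _))// mulr_ge0// ltW.
rewrite lee_fin size_s /tau le_eqVlt; apply/orP; left; apply/eqP.
have two_n : (0 < (2 ^ n)%:R :> R)%R by rewrite ltr0n expn_gt0.
by field; apply/andP; split; apply: lt0r_neq0; rewrite ?powR_gt0.
Qed.

(** S is a packing subfamily of the maximal heavy cubes, and G consists of the
dyadic cubes whose weight is filled by the members of S below them. A maximal
heavy cube lies below a member of G, and a member of S lies below at most one
maximal member of G. *)
Lemma A1_weak_type f (t : R) : L1w d w f -> (0 < t)%R ->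
  I [set x | t%:E < maximal d f x] w <=
  (K * 3 `^ d * packing_const n d * ((2 ^ n)%:R * 2 `^ d / c1) / t)%:E *
    I setT (fun x => `|f x| * w x).
Proof.
move=> fL t0; set J := I setT _.
pose tau := (c1 / ((2 ^ n)%:R * 2 `^ d) * t)%R.
have tau0 : (0 < tau)%R.
  by rewrite mulr_gt0 ?divr_gt0 ?mulr_gt0 ?unit_content_gt0 ?powR_gt0// ltr0n expn_gt0.
pose C := (K * 3 `^ d / tau)%R.
have C0 : (0 < C)%R by rewrite divr_gt0// mulr_gt0// powR_gt0.
have J0 : 0 <= J by exact: choquet_ge0.
pose g P := I (dcube P) (fun y => `|f y| * w y).
have g0 P : 0 <= g P by exact: choquet_ge0.
pose F := heavy f tau.
(* A heavy cube fills its own weight, so the estimate applies to the family {P}. *)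
have F_bounded P : F P -> I (dilate P) w <= C%:E * J.
  move=> FP; apply: (le_trans (@wcontent_dilate_le [set P] P f tau tau0 _ _)).
  - by move=> _ ->; exact: ltW.
  - rewrite -(@esum_set1 R _ P (fun P => (wt P)%:E)) ?weight_ge0//.
    by apply: sub_esum => _ ->; split => //; exact: below_refl.
  rewrite lee_pmul2l//; apply: (@le_trans _ _ (\esum_(P' in [set P]) g P')).
    by apply: sub_esum => ? [].
  by rewrite esum_set1//; exact: le_choquet.
have CJ : C%:E * J < +oo by rewrite lte_mul_pinfty// lee_fin ltW.
pose F0 := maximal_dyadic F.
have [S [SF0 packS coverS]] := packing_selection d0 F0.
have disjS : disjoint_family S.
  by move=> P Q /SF0 maxP /SF0 maxQ PQ; apply: maximal_dyadic_eq maxP maxQ (or_introl PQ).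
have Sg : \esum_(P in S) g P <= (packing_const n d)%:E * J by exact: packing_choquet.
have heavyS P : S P -> (tau * wt P)%:E <= I (dcube P) (fun y => `|f y|).
  by move=> /SF0[/ltW].
pose G := [set Q | (wt Q)%:E <= family_weight d S Q].
have G_le Q : G Q -> I (dilate Q) w <= C%:E * \esum_(P in S `&` below^~ Q) g P.
  exact: wcontent_dilate_le.
have G_bounded Q : G Q -> I (dilate Q) w <= C%:E * ((packing_const n d)%:E * J).
  move=> /G_le/le_trans; apply; rewrite lee_pmul2l//; apply: le_trans Sg.
  by apply: sub_esum => P [].
have CJ' : C%:E * ((packing_const n d)%:E * J) < +oo.
  apply: lte_mul_pinfty => //; first by rewrite lee_fin ltW.
  by apply: lte_mul_pinfty => //; rewrite lee_fin ltW// packing_const_gt0.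
pose G0 := maximal_dyadic G.
have coverE : [set x | t%:E < maximal d f x] `<=` \bigcup_(Q in G0) dilate Q.
  move=> x /(maximal_gt_heavy t0)[P FP Px].
  have [P0 maxP0 PP0] := exists_maximal_of_bounded CJ F_bounded FP.
  have [Q P0Q GQ] := coverS _ maxP0.
  have [Q0 maxQ0 QQ0] := exists_maximal_of_bounded CJ' G_bounded GQ.
  exists Q0 => //; apply: (below_dilate _ Px).
  exact: below_trans PP0 (below_trans P0Q QQ0).
apply: le_trans (choquet_sub _ _ coverE) _.
apply: (@le_trans _ _ (\esum_(Q in G0) (C%:E * \esum_(P in S `&` below^~ Q) g P))).
  by apply: le_esum => Q [GQ _]; exact: G_le.
rewrite esumZl ?(ltW C0)//; last by move=> Q; apply: esum_ge0.
apply: (@le_trans _ _ (C%:E * \esum_(P in S) g P)).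
  rewrite lee_pmul2l//; apply: esum_disjoint_le => //.
  move=> Q Q' P maxQ maxQ' [_ PQ] [_ PQ'].
  exact: maximal_dyadic_eq maxQ maxQ' (below_total PQ PQ').
apply: (@le_trans _ _ (C%:E * ((packing_const n d)%:E * J))).
  by rewrite lee_pmul2l.
rewrite muleA -EFinM le_eqVlt; apply/orP; left; apply/eqP; congr (_%:E * _).
rewrite /C /tau; field.
by rewrite !gt_eqF ?powR_gt0 ?unit_content_gt0 ?ltr0n ?expn_gt0.
Qed.

End A1Weights.

End Weights.

(** * Weights with the weak type inequality are in A1 *)

Section WeakType.
Variables (R : realType) (n : nat) (d : R) (w : 'rV[R]_n -> \bar R).
Hypothesis d0 : (0 < d)%R.
Hypothesis w_weight : capacitary_weight d w.
Hypothesis unit_gt0 : 0 < hcontent d (cube (0 : 'rV[R]_n)%R 1%R).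
Implicit Types (E : set 'rV[R]_n) (a x : 'rV[R]_n) (l : R).
Local Notation H := (@hcontent R n d).
Local Notation I := (@choquet R n d).
Local Notation c1 := (@unit_content R n d).

Variable K : R.
Hypotheses (K0 : (0 < K)%R)
  (weakK : forall f, L1w d w f -> forall t : R, (0 < t)%R ->
      wcontent d w [set x | t%:E < maximal d f x] <=
      (K / t)%:E * choquet d setT (fun x => `|f x| * w x)).

Definition low_set a l : set 'rV[R]_n :=
  [set x | cube a l x /\ (3 * K)%:E * H (cube a l) * w x < I (cube a l) w].

(** The indicator of the low set has a maximal function bounded below on the
whole cube by its relative content, while its weighted integral is small because
w is small there; the two are compatible with the weak type inequality only when
the low set is negligible. *)
Lemma low_set_null a l : (0 < l)%R -> H (low_set a l) = 0.
Proof.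
move=> l0; have w0 x : 0 <= w x by exact: (w_ge0 w_weight).
pose h := (l `^ d * c1)%R.
have hE : H (cube a l) = h%:E by exact: hcontent_cubeE.
have h0 : (0 < h)%R by rewrite mulr_gt0 ?(unit_content_gt0 unit_gt0)// powR_gt0.
pose B := fine (I (cube a l) w).
have BE : I (cube a l) w = B%:E by rewrite fineK// (wcontent_cube_fin w_weight).
pose F := low_set a l.
have FQ : F `<=` cube a l by move=> x [].
apply/eqP; rewrite eq_le hcontent_ge0 andbT leNgt; apply/negP => F_gt0.
have [x0 Fx0] : exists x, F x.
  apply: contrapT => noF; move: F_gt0; rewrite (_ : low_set a l = set0) ?hcontent0 ?ltxx//.
  by apply/seteqP; split=> // x Fx; apply: noF; exists x.
have B0 : (0 < B)%R.
  rewrite -lte_fin -BE; apply: le_lt_trans Fx0.2.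
  by rewrite !mule_ge0// ?hcontent_ge0// lee_fin mulr_ge0// ltW.
have HF_le : H F <= h%:E by rewrite -hE; exact: le_hcontent.
pose m := fine (H F).
have mE : H F = m%:E.
  by rewrite fineK// ge0_fin_numE ?hcontent_ge0//; apply: le_lt_trans HF_le _; rewrite ltey.
have m0 : (0 < m)%R by rewrite -lte_fin -mE.
pose s := (B / (3 * K * h))%R.
have Kh0 : (0 < 3 * K * h)%R by apply: mulr_gt0 => //; apply: mulr_gt0.
have ws x : F x -> w x <= s%:E.
  move=> [_ /ltW]; rewrite hE BE -EFinM => low.
  by rewrite /s mulrC EFinM lee_pdivlMl.
pose f x := (\1_F x : R)%:E.
have fF x : F x -> f x = 1 by move=> Fx; rewrite /f indicE mem_set.
have f0 x : 0 <= f x by rewrite lee_fin.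
have fw : I setT (fun x => `|f x| * w x) <= (s * m)%:E.
  rewrite EFinM -mE.
  apply: (@le_trans _ _ (I F w)); last first.
    by apply: choquet_le_bound => //; rewrite divr_ge0// ltW.
  apply: le_choquet_layer => t t0; apply: le_hcontent => x [_].
  rewrite gee0_abs//; have [Fx|nFx] := pselect (F x); first by rewrite fF// mul1e.
  by rewrite /f indicE memNset// mul0e lte_fin ltNge (ltW t0).
have fL : L1w d w f by apply: le_lt_trans fw _; rewrite ltey.
(* Half the relative content of F: the resulting loss of a factor 2 is absorbed by
   the factor 3 in the definition of the low set. *)
pose t := (m / (2 * h))%R.
have t0 : (0 < t)%R by apply: divr_gt0 => //; apply: mulr_gt0.
have Mf : cube a l `<=` [set x | t%:E < maximal d f x].
  move=> x Qx /=.
  apply: (@lt_le_trans _ _ ((H (cube a l))^-1 * I (cube a l) (fun y => `|f y|))); last first.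
    by apply: ereal_sup_ubound; exists (cube a l) => //; split=> //; exists a, l.
  rewrite hE inver gt_eqF// lte_pdivlMl// -EFinM.
  apply: (@lt_le_trans _ _ m%:E).
    rewrite lte_fin /t (_ : (h * _)%R = m / 2)%R; last by field; rewrite gt_eqF.
    by rewrite ltr_pdivrMr//; lra.
  rewrite -mE -[leLHS]mul1e; apply: (@le_trans _ _ (I F (fun y => `|f y|))).
    by apply: choquet_ge_bound => // x' Fx'; rewrite gee0_abs// fF.
  by apply: le_choquet.
have := weakK fL t0.
have : B%:E <= wcontent d w [set x | t%:E < maximal d f x].
  by rewrite -BE; apply: le_choquet.
move=> /le_trans /[apply].
have Kt0 : 0 <= (K / t)%:E by rewrite lee_fin divr_ge0// ltW.
move=> /le_trans -/(_ _ (lee_wpmul2l Kt0 fw)); rewrite -EFinM lee_fin.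
rewrite (_ : (K / t * _)%R = B * (2 / 3))%R; last first.
  by rewrite /t /s; field; rewrite !gt_eqF.
lra.
Qed.

(** The low sets of the dilates of all dyadic cubes form a negligible set; off that
set the mean of w over any cube is controlled by passing to a dilate that contains
the cube and is at most 6 times as long. *)
Lemma weak_type_A1 : A1 d w.
Proof.
exists (3 * K * 6 `^ d)%R; split; first by rewrite !mulr_gt0// powR_gt0.
pose corner (P : dyadic n) : 'rV[R]_n := (\row_i (side R P * (P.2 ord0 i - 2)%:~R))%R.
exists (\bigcup_P low_set (corner P) (3 * side R P)); split.
  by apply: hcontent_null_bigcup => P; apply: low_set_null; rewrite mulr_gt0// side_gt0.
move=> x notlow; apply: ge_ereal_sup => _ [Q [[a [l [l0 ->]]] Qx] <-].
have [s [_ covs s_le]] := @cube_dyadic_cover R n a l l0.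
have [P sP _] := covs x Qx; have [QP Pl] := s_le P sP.
have S0 : (0 < 3 * side R P)%R by rewrite mulr_gt0// side_gt0.
have : I (dilate P) w <= (3 * K)%:E * H (dilate P) * w x.
  rewrite leNgt; apply/negP => low; apply: notlow; exists P => //.
  by split=> //; exact: QP.
rewrite [H (dilate P)]hcontent_cubeE// => mean_le.
have h0 : (0 < l `^ d * c1)%R by rewrite mulr_gt0 ?(unit_content_gt0 unit_gt0)// powR_gt0.
rewrite hcontent_cubeE// inver gt_eqF// lee_pdivrMl//.
rewrite (_ : I _ (fun y => `|w y|) = I (cube a l) w); last first.
  by congr choquet; apply/funext => y; rewrite gee0_abs// (w_ge0 w_weight).
apply: (@le_trans _ _ (I (dilate P) w)); first exact: le_choquet.
apply: le_trans mean_le _; rewrite muleA -!EFinM.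
apply: lee_wpmul2r; first exact: (w_ge0 w_weight).
rewrite lee_fin (_ : (l `^ d * c1 * _ = 3 * K * ((6 `^ d * l `^ d) * c1))%R); last by ring.
rewrite ler_pM2l ?mulr_gt0// ler_pM2r ?(unit_content_gt0 unit_gt0)// -powRM ?(ltW l0)//.
rewrite ge0_ler_powR ?nnegrE ?(ltW d0) ?(ltW S0)//; last by lra.
by rewrite mulr_ge0// ltW.
Qed.

End WeakType.

(** * The equivalence *)

Lemma hcontent_eq0 (R : realType) (n : nat) (d : R) :
    hcontent d (cube (0 : 'rV[R]_n)%R 1%R) = 0 ->
  forall E : set 'rV[R]_n, hcontent d E = 0.
Proof.
move=> unit0 E; apply/eqP; rewrite eq_le hcontent_ge0 andbT.
have null (P : dyadic n) : hcontent d (dcube P : set 'rV[R]_n) = 0.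
  by rewrite dcubeE hcontent_cube ?side_gt0// unit0 mule0.
rewrite -(hcontent_null_bigcup null); apply: le_hcontent => x _.
by exists (dyadic_at 0 x).
Qed.

Theorem theorem1p2 (R : realType) (n : nat) (d : R) (w : 'rV[R]_n -> \bar R)
  (hd0 : (0 < d)%R) (hdn : (d <= n%:R)%R) (hw : capacitary_weight d w) :
  maximal_weak11 d w <-> A1 d w.
Proof.
have := hcontent_ge0 d (cube (0 : 'rV[R]_n)%R 1%R).
rewrite le_eqVlt => /predU1P[/esym/hcontent_eq0 H0|unit_gt0].
  (* Every set is negligible, hence all integrals vanish. *)
  have I0 (E : set 'rV[R]_n) f : choquet d E f = 0 by apply: integral0_eq => t _; exact: H0.
  split=> _; exists 1%R; split=> //.
    by exists setT; split=> // x /(_ I).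
  by move=> f _ t t0; rewrite /wcontent !I0 mule0.
split=> [[K [K0 weakK]]|/(A1_cubes hw unit_gt0)[K [N [K0 N0 A1w]]]].
  exact: weak_type_A1 hw unit_gt0 K K0 weakK.
exists (K * 3 `^ d * packing_const n d * ((2 ^ n)%:R * 2 `^ d / @unit_content R n d))%R; split.
  rewrite !mulr_gt0 ?powR_gt0 ?packing_const_gt0// ?ltr0n ?expn_gt0// invr_gt0.
  exact: (unit_content_gt0 unit_gt0).
by move=> f fL t t0; exact: (A1_weak_type hd0 hw unit_gt0 K0 N0 A1w fL t0).
Qed.
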